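(* Every crowded D$^+$-separable space is $\omega$-resolvable (and hence non-submaximal).
   Context: A topological space is crowded if it has no isolated points. A subset of a space is discrete if it is discrete in its subspace topology. A space $X$ is D$^+$-separable if player Two has a winning strategy in the following game of length $\omega$ on $X$: at inning $n\in\omega$, One picks a dense subspace $D_n\subset X$, then Two picks a discrete set $F_n\subset D_n$; Two wins if $\bigcup_{n\in\omega}F_n$ is dense in $X$. $X$ is $\omega$-resolvable if it contains a countably infinite family of pairwise disjoint dense subspaces. $X$ is submaximal if every subset of $X$ is open in its closure.
   Formalization: The space is assumed to be nonempty and T0: without these the claim fails, since the two-point indiscrete space and the empty space are both crowded and D⁺-separable but not ω-resolvable. *)

(* Defs.v *)
From mathcomp Require Import all_boot all_classical.
From mathcomp Require Import topology.

Set Implicit Arguments.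
Unset Strict Implicit.
Unset Printing Implicit Defensive.

Local Open Scope classical_set_scope.

Definition crowded (X : topologicalType) : Prop :=
  forall x : X, ~ isolated [set: X] x.

(* [set_type F] carries the topology induced by the inclusion in [X]. *)
Definition discrete_subset (X : topologicalType) (F : set X) : Prop :=
  forall B : set (set_type F), open B.

(* A strategy of Two maps the finite sequence D_0, ..., D_n of the moves made
   so far by One to Two's answer F_n; Two's own earlier moves are determined by
   it, hence are not part of the argument. *)
Definition strategy (X : topologicalType) := seq (set X) -> set X.

Definition answer (X : topologicalType) (sigma : strategy X)
  (D : nat -> set X) (n : nat) : set X := sigma (mkseq D n.+1).

(* Two's answers must be legal moves, and their union must be dense, against
   every sequence of legal moves of One. *)
Definition winning_strategy (X : topologicalType) (sigma : strategy X) : Prop :=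
  forall D : nat -> set X, (forall n, dense (D n)) ->
    (forall n, answer sigma D n `<=` D n /\
               discrete_subset (answer sigma D n)) /\
    dense (\bigcup_n answer sigma D n).

Definition Dplus_separable (X : topologicalType) : Prop :=
  exists sigma : strategy X, winning_strategy sigma.

(* Injectivity of the enumeration makes the family infinite as a set of
   subspaces; it is automatic when [X] is nonempty. *)
Definition omega_resolvable (X : topologicalType) : Prop :=
  exists E : nat -> set X,
    [/\ injective E, forall n, dense (E n) &
        forall m n, m <> n -> E m `&` E n = set0].

Definition submaximal (X : topologicalType) : Prop :=
  forall A : set X, open (A : set (subspace (closure A))).

(* Main.v *)
(** Two's answers are discrete, and in a crowded T0 space a finite union of
    discrete sets has a dense complement: a nonempty open subset of such a union
    can be shrunk, one discrete set at a time, to a nonempty finite open set,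
    and in a T0 space a nonempty finite open set has an isolated point. One can
    therefore play countably many games simultaneously against a winning
    strategy of Two, each time offering the complement of all the answers
    collected so far in all the games. The answers of different games are then
    disjoint, and in each game their union is dense. *)
Require Import Defs.
From mathcomp Require Import all_boot all_classical.
From mathcomp Require Import topology.

Set Implicit Arguments.
Unset Strict Implicit.

Local Open Scope classical_set_scope.

Lemma discrete_subset_isolated (X : topologicalType) (F : set X) (x : X) :
  discrete_subset F -> F x ->
  exists V : set X, [/\ open V, V x & V `&` F `<=` [set x]].
Proof.
move=> Fdiscr Fx.
have [V oV VE] := Fdiscr [set SigSub (mem_set Fx)].
exists V; split=> //.
  have : (set_val @^-1` V) (SigSub (mem_set Fx)) by rewrite VE.
  by [].
move=> y [Vy Fy].
have : (set_val @^-1` V) (SigSub (mem_set Fy)) by [].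
by rewrite VE => /(congr1 val).
Qed.

Lemma kolmogorov_open (X : topologicalType) (x y : X) :
  kolmogorov_space X -> x <> y ->
  exists V : set X, open V /\ (V x /\ ~ V y \/ V y /\ ~ V x).
Proof.
move=> T0 /eqP /T0 [A AE].
exists (interior A); split; first exact: open_interior.
by case: AE => -[/set_mem Anbhs /set_mem nA]; [left|right]; split=> // /interior_subset.
Qed.

Section crowded_kolmogorov.
Variables (X : topologicalType).
Hypotheses (T0 : kolmogorov_space X) (Xcrowded : crowded X).

Lemma crowded_open_neq (U : set X) (x : X) :
  open U -> U x -> exists2 y, U y & x <> y.
Proof.
move=> oU Ux; apply: contrapT => noy; apply: (@Xcrowded x).
split; first exact: in_setT.
exists U; first exact: open_nbhs_nbhs.
rewrite setIT; apply/seteqP; split=> [y Uy|y ->] //=.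
by apply: contrapT => yx; apply: noy; exists y => // xy; apply: yx.
Qed.

(** By induction on the size of [s]: an open [V] contains exactly one of two distinct points of [U],
    so its intersection with [U] is nonempty, yet is covered by one point fewer. *)
Lemma finite_open_eq0 (s : seq X) (U : set X) :
  open U -> U `<=` [set` s] -> U = set0.
Proof.
have [n] := ubnP (size s); elim: n s U => // n IH s U; rewrite ltnS => sn oU Us.
apply/eqP/negP => /negP /set0P [x Ux].
have [y Uy xy] := crowded_open_neq oU Ux.
have [V [oV Vxy]] := kolmogorov_open T0 xy.
have shrink a b : U b -> V a -> U a -> ~ V b -> False.
  move=> Ub Va Ua nVb.
  suff UV0 : U `&` V = set0 by have : (U `&` V) a by []; rewrite UV0.
  have bs : b \in s := Us _ Ub.
  apply: (IH (rem b s)); [|exact: openI|].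
  - by rewrite size_rem //; apply: leq_trans sn; rewrite ltn_predL; case: (s) bs.
  - move=> z [Uz Vz] /=; have zs : z \in s := Us _ Uz.
    move: zs; rewrite (perm_mem (perm_to_rem bs)) inE => /predU1P[zb|//].
    by rewrite zb in Vz.
by case: Vxy => -[Va nVb]; [apply: (shrink x y)|apply: (shrink y x)].
Qed.

(** The list [s] collects the points left over from the sets already treated: if [U] meets [F i] at
    [x], shrink [U] to a neighbourhood isolating [x] in [F i] and add [x] to [s]; otherwise drop
    [F i]. *)
Lemma open_sub_discreteU_eq0 (I : Type) (F : I -> set X) (r : seq I)
    (s : seq X) (U : set X) :
  (forall i, discrete_subset (F i)) -> open U ->
  U `<=` [set` s] `|` \big[setU/set0]_(i <- r) F i -> U = set0.
Proof.
move=> Fdiscr; elim: r s U => [|i r IH] s U oU.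
  by rewrite big_nil setU0; apply: finite_open_eq0.
rewrite big_cons => Us.
apply/eqP/negP => /negP /set0P [y Uy].
have [[x [Ux Fx]]|nFx] := pselect (exists x, U x /\ F i x).
  have [V [oV Vx VF]] := discrete_subset_isolated (Fdiscr i) Fx.
  have : (U `&` V) x by [].
  rewrite (IH (x :: s) (U `&` V)) //; first exact: openI.
  move=> z [Uz Vz]; case: (Us _ Uz) => [zs|[Fz|Fz]].
  - by left; rewrite /= inE zs orbT.
  - by left; rewrite (VF z (conj Vz Fz)) /= mem_head.
  - by right.
have : U y by [].
rewrite (IH s U) // => z Uz; case: (Us _ Uz) => [zs|[Fz|Fz]].
- by left.
- by case: nFx; exists z.
- by right.
Qed.

Lemma dense_setC_discreteU (I : choiceType) (F : I -> set X) (P : set I) :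
  finite_set P -> (forall i, discrete_subset (F i)) ->
  dense (~` \bigcup_(i in P) F i).
Proof.
move=> /finite_seqP [r ->] Fdiscr U /set0P U0 oU; apply: contrapT => UF.
move/eqP: U0; apply; apply: (@open_sub_discreteU_eq0 I F r [::] U) => //.
move=> x Ux; right; rewrite -bigcup_seq; apply: contrapT => nFx.
by apply: UF; exists x.
Qed.

End crowded_kolmogorov.

(* The stage at which inning [n] of game [g] is played. *)
Definition stage (g n : nat) : nat := 2 ^ g * n.*2.+1.

Lemma leq_stage (g n m : nat) : n <= m -> stage g n <= stage g m.
Proof. by move=> nm; rewrite leq_mul2l ltnS leq_double nm orbT. Qed.

(** Since [n.*2.+1] is odd, [g] is the 2-adic valuation of the stage. *)
Lemma stage_inj (g n h m : nat) : stage g n = stage h m -> g = h.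
Proof.
have lognE a b : logn 2 (stage a b) = a.
  by rewrite lognM ?expn_gt0 // pfactorK // lognE /= dvdn2 /= odd_double addn0.
by move=> /(congr1 (logn 2)); rewrite !lognE.
Qed.

Lemma ltn_game_stage (g n : nat) : g < stage g n.
Proof. by apply: (leq_trans (ltn_expl g (ltnSn 1))); rewrite leq_pmulr. Qed.

Lemma ltn_inning_stage (g n : nat) : n < stage g n.
Proof.
apply: (@leq_trans n.*2.+1); first by rewrite ltnS -addnn leq_addr.
by rewrite leq_pmull // expn_gt0.
Qed.

Lemma finite_stage_lt (k : nat) :
  finite_set [set p : nat * nat | stage p.1 p.2 < k].
Proof.
apply: (@sub_finite_set _ _ (`I_k `*` `I_k)).
  move=> [g n] /= gnk.
  by split; apply: ltn_trans gnk; [apply: ltn_game_stage|apply: ltn_inning_stage].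
by apply: finite_setX; apply: finite_II.
Qed.

Section simultaneous_games.
Variables (X : topologicalType) (sigma : strategy X).
Hypotheses (T0 : kolmogorov_space X) (Xcrowded : crowded X).
Hypothesis sigma_wins : winning_strategy sigma.

(* [D k] is the move made by One at stage [k], in whichever game it belongs to. *)
Definition game_answer (D : nat -> set X) (g n : nat) : set X :=
  answer sigma (fun i => D (stage g i)) n.

Definition fresh (D : nat -> set X) (k : nat) : set X :=
  ~` \bigcup_(p in [set p | stage p.1 p.2 < k]) game_answer D p.1 p.2.

(* The moves made before stage [k]; the dense set [setT] stands for the moves
   still to be made. *)
Fixpoint moves_before (k : nat) : nat -> set X :=
  if k is k'.+1 then
    fun j => if j == k' then fresh (moves_before k') k' else moves_before k' j
  else fun=> setT.

Definition moves (k : nat) : set X := fresh (moves_before k) k.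

Lemma moves_beforeE (k j : nat) : j < k -> moves_before k j = moves j.
Proof.
elim: k => // k IH; rewrite ltnS leq_eqVlt /= => /predU1P[->|jk].
  by rewrite eqxx.
by rewrite (ltn_eqF jk) IH.
Qed.

(** The answer depends only on the innings [i <= n] of game [g], whose stages are at most
    [stage g n]. *)
Lemma game_answer_before (k g n : nat) : stage g n < k ->
  game_answer (moves_before k) g n = game_answer moves g n.
Proof.
move=> gnk; congr (sigma _); apply/eq_in_map => i.
rewrite mem_iota add0n ltnS => /andP[_ /(leq_stage g) ign].
by rewrite moves_beforeE //; apply: leq_ltn_trans gnk.
Qed.

Lemma movesE (k : nat) : moves k = fresh moves k.
Proof.
congr (~` _); apply: eq_bigcupr => -[g n] /= gnk.
exact: game_answer_before.
Qed.

(** Density of every [D j] makes all answers discrete, and only finitely many of them precede stage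
    [k]. *)
Lemma dense_fresh (D : nat -> set X) (k : nat) :
  (forall j, dense (D j)) -> dense (fresh D k).
Proof.
move=> Ddense; apply: (@dense_setC_discreteU X T0 Xcrowded) => [|[g n] /=].
  exact: finite_stage_lt.
by have [/(_ n)[]] := sigma_wins (fun i => Ddense (stage g i)).
Qed.

Lemma dense_moves (k : nat) : dense (moves k).
Proof.
apply: dense_fresh; elim: k => [j|k IH j] /=.
  by move=> U U0 _; rewrite setIT.
by case: ifP => _; [apply: dense_fresh|apply: IH].
Qed.

Lemma game_answer_sub (g n : nat) : game_answer moves g n `<=` moves (stage g n).
Proof. by have [/(_ n)[]] := sigma_wins (fun i => dense_moves (stage g i)). Qed.

Lemma game_answer_disjoint (g n h m : nat) : g <> h ->
  game_answer moves g n `&` game_answer moves h m = set0.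
Proof.
(* The answer at the later stage lies in a move that avoids the earlier answer. *)
move=> gh; wlog gnhm : g n h m gh / stage g n < stage h m.
  move=> wl; have [lt|lt|/stage_inj//] := ltngtP (stage g n) (stage h m).
    exact: wl.
  by rewrite setIC; apply: wl => // hg; apply: gh.
apply/seteqP; split=> // x [xg /game_answer_sub]; rewrite movesE; apply.
by exists (g, n).
Qed.

Lemma winning_strategy_disjoint_dense :
  exists E : nat -> set X, (forall n, dense (E n)) /\
    (forall m n, m <> n -> E m `&` E n = set0).
Proof.
exists (fun g => \bigcup_n game_answer moves g n); split=> [g|g h gh].
  by have [] := sigma_wins (fun i => dense_moves (stage g i)).
apply/seteqP; split=> // x [[n _ xg] [m _ xh]].
by rewrite -(game_answer_disjoint n m gh).
Qed.

End simultaneous_games.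

Lemma dense_nonempty (X : topologicalType) (A : set X) :
  [set: X] !=set0 -> dense A -> A !=set0.
Proof. by move=> X0 /(_ setT X0 openT) [x [_ Ax]]; exists x. Qed.

Lemma dense_closureT (X : topologicalType) (A : set X) :
  dense A -> closure A = setT.
Proof.
move=> Adense; apply/seteqP; split=> // x _ B; rewrite nbhsE => -[U [oU Ux] UB].
have [y [Uy Ay]] := Adense U (ex_intro _ x Ux) oU.
by exists y; split=> //; apply: UB.
Qed.

Lemma submaximal_dense_open (X : topologicalType) (A : set X) :
  submaximal X -> dense A -> open A.
Proof.
move=> /(_ A) Aopen Adense.
have [V oV] := (open_subspaceP _ _).1 Aopen.
by rewrite (dense_closureT Adense) !setIT => <-.
Qed.

Theorem theorem76 (X : topologicalType) (X_nonempty : [set: X] !=set0)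
    (X_T0 : @kolmogorov_space X) (X_crowded : crowded X)
    (X_Dplus : Dplus_separable X) :
  omega_resolvable X /\ ~ submaximal X.
Proof.
have [sigma sigma_wins] := X_Dplus.
have [E [Edense Edisj]] :=
  winning_strategy_disjoint_dense X_T0 X_crowded sigma_wins.
split.
  (* Equal members with distinct indices would be disjoint from themselves, hence empty. *)
  exists E; split=> // m n Emn; apply: contrapT => /Edisj.
  rewrite Emn setIid => En0.
  by have [x] := dense_nonempty X_nonempty (Edense n); rewrite En0.
(* Submaximality would make the dense set [E 0] open, so that it would meet [E 1]. *)
move=> Xsub; have E0open := submaximal_dense_open Xsub (Edense 0).
have [x] := Edense 1 _ (dense_nonempty X_nonempty (Edense 0)) E0open.
by rewrite Edisj.
Qed.
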